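(* Suppose that $n\ge 3$ and that the following three assumptions hold. (A1) Each $C(t_k)$, $k\ge 0$, is a doubly stochastic matrix with zero diagonal elements, and there exists a constant $\gamma>0$ such that $c_{ij}(t_k)\ge\gamma$ for all nonzero $c_{ij}(t_k)$. (A2) There exists an integer $B\ge 1$ such that the union graph $\bigcup_{k=l}^{l+B-1}\mathbb{G}(t_k)$ is strongly connected for all integers $l\ge 0$. (A3) There exist two positive constants $\bar{\tau}_D$ and $\underline{\tau}_D$ such that $\bar{\tau}_D\ge\tau_k\ge\underline{\tau}_D$ for all $k\ge 0$. Consider the system $$\dot{x}_i(t)=-(1-x_i(t))x_i(t)+\sum_{j=1}^n c_{ji}(t_k)(1-x_j(t))x_j(t),\quad i\in\mathcal V,\ t\in[t_k,t_{k+1}),\ k\ge 0 .$$ Then: (a) $\Delta_n$ is a positive invariant set of the system, i.e., for any initial condition $x(t_0)\in\Delta_n$, $x(t)\in\Delta_n$ for all $t\ge t_0$. (b) If $x(t_0)\in\Delta_n\setminus\{e_1,\dots,e_n\}$ and $x(t_0)$ has $m$ nonzero entries, $m\ge 2$, then $\lim_{t\to\infty}x_i(t)=\frac1n$ for all $i\in\mathcal V$, and the convergence is exponentially fast with a rate given by $$V(t)\le\Big(1-\alpha\mu^{n-1}\Big)^{-\frac{1+2B(n-1)}{B(n-1)}}e^{-\lambda t}\,V(t_0)\quad\text{for all } t\ge t_0,$$ where $$\alpha= e^{-\bar{\tau}_D B(n-1)\left(1-2l(t_{(n-m)B})\right)},\qquad \mu=\alpha\gamma\Big(1-e^{-\underline{\tau}_D\,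 l(t_{(n-m)B})}\Big),\qquad \lambda=\frac{\ln\big[(1-\alpha\mu^{n-1})^{-1}\big]}{B\bar{\tau}_D(n-1)},$$ with $l(t_{(n-m)B})=\min_{i\in\mathcal V}\{x_i(t_{(n-m)B})\}>0$.
   Context: Let $n>1$ be an integer and $\mathcal V=\{1,\dots,n\}$. Let $\Delta_n=\{x\in\mathbb{R}^n: x_i\ge 0 \text{ for } i\in\mathcal V,\ \sum_{i=1}^n x_i=1\}$, and let $e_i$ be the vector in $\mathbb{R}^n$ whose $i$th entry is $1$ and whose other entries are $0$. For each $t\ge 0$, $C(t)=[c_{ij}(t)]_{n\times n}$ is a row-stochastic matrix (nonnegative entries, each row sums to $1$) with zero diagonal, called the relative interaction matrix. It is piecewise constant in time: there is an infinite sequence of times $0=t_0<t_1<t_2<\cdots$ such that $C(t)=C(t_k)$ for $t\in[t_k,t_{k+1})$, $k\ge 0$. The dwell times are $\tau_k=t_{k+1}-t_k>0$. A matrix is doubly stochastic if it is nonnegative and all its row sums and column sums equal $1$. $\mathbb{G}(t)$ is the directed graph with vertex set $\mathcal V$ that has an arc from $i$ to $j$ if and only if $c_{ij}(t)>0$. The union of graphs on the vertex set $\mathcal V$ is the graph on $\mathcal V$ whose arc set is the union of the arc sets. A solution of the system is a continuous function $x(t)=[x_1(t),\dots,x_n(t)]^\top$, $t\ge t_0$, satisfying the differential equation on each interval $[t_k,t_{k+1})$ (right derivative at $t_k$). Along a solution, define $h(t)=\max_{i\in\mathcal V}x_i(t)$, $l(t)=\min_{i\in\mathcal V}x_i(t)$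 and $V(t)=h(t)-l(t)$. (In (A2) the letter $l$ denotes an integer index; $l(\cdot)$ with a time argument denotes the minimum function.) *)

(* Defs.v *)
(* MathComp / MathComp-Analysis, over an abstract [R : realType]. *)
From HB Require Import structures.
From mathcomp Require Import all_boot all_order all_algebra.
From mathcomp Require Import all_classical all_reals all_analysis.
Set Implicit Arguments.
Unset Strict Implicit.
Unset Printing Implicit Defensive.
Import Order.TTheory GRing.Theory Num.Theory.
Import numFieldNormedType.Exports.
Local Open Scope classical_set_scope.
Local Open Scope ring_scope.

Definition row_stochastic (R : realType) (n : nat) (C : 'M[R]_n) : Prop :=
  (forall i j, 0 <= C i j) /\ (forall i, \sum_j C i j = 1).

Definition doubly_stochastic (R : realType) (n : nat) (C : 'M[R]_n) : Prop :=
  [/\ forall i j, 0 <= C i j,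
      forall i, \sum_j C i j = 1
    & forall j, \sum_i C i j = 1].

Definition zero_diagonal (R : realType) (n : nat) (C : 'M[R]_n) : Prop :=
  forall i, C i i = 0.

Definition digraph_of (R : realType) (n : nat) (C : 'M[R]_n) : rel 'I_n :=
  [rel i j | 0 < C i j].

(* Union of the graphs [G l], ..., [G (l + B - 1)]. *)
Definition union_graph (T : Type) (G : nat -> rel T) (l B : nat) : rel T :=
  [rel i j | has (fun k => G k i j) (iota l B)].

Definition strongly_connected (T : finType) (e : rel T) : Prop :=
  forall i j, connect e i j.

Definition simplex (R : realType) (n : nat) : set 'cV[R]_n :=
  [set v | (forall i, 0 <= v i 0) /\ \sum_i v i 0 = 1].

Definition simplex_vertices (R : realType) (n : nat) : set 'cV[R]_n :=
  range (fun i : 'I_n => delta_mx i 0).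

Definition entries (R : realType) (n : nat) (v : 'cV[R]_n) : seq R :=
  [seq v i 0 | i <- enum 'I_n].

(* The unit of the iterated max/min is the first entry, so that for [n > 0]
   these are the true maximum and minimum; see [vmaxP] and [vminP]. *)
Definition vmax (R : realType) (n : nat) (v : 'cV[R]_n) : R :=
  \big[Num.max/head 0 (entries v)]_i v i 0.

Definition vmin (R : realType) (n : nat) (v : 'cV[R]_n) : R :=
  \big[Num.min/head 0 (entries v)]_i v i 0.

Lemma entriesP (R : realType) (n : nat) (v : 'cV[R]_n) (a : R) :
  reflect (exists i, a = v i 0) (a \in entries v).
Proof.
apply: (iffP mapP) => [[i _ ->]|[i ->]]; first by exists i.
by exists i; rewrite ?mem_enum.
Qed.

Lemma head_entries (R : realType) (n : nat) (v : 'cV[R]_n) :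
  (0 < n)%N -> head 0 (entries v) \in entries v.
Proof.
move=> n0; have: (0 < size (entries v))%N by rewrite size_map size_enum_ord.
by case: (entries v) => //= a s _; rewrite mem_head.
Qed.

Lemma vmaxP (R : realType) (n : nat) (v : 'cV[R]_n) : (0 < n)%N ->
  (exists i, vmax v = v i 0) /\ (forall i, v i 0 <= vmax v).
Proof.
move=> n0; split=> [|i].
  apply/entriesP; rewrite /vmax.
  elim/big_ind : _ => //; first exact: head_entries.
  by move=> a b sa sb; rewrite /Num.max; case: ifP.
  by move=> i _; apply/entriesP; exists i.
exact: (le_bigmax _ (fun j => v j 0)).
Qed.

Lemma vminP (R : realType) (n : nat) (v : 'cV[R]_n) : (0 < n)%N ->
  (exists i, vmin v = v i 0) /\ (forall i, vmin v <= v i 0).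
Proof.
move=> n0; split=> [|i].
  apply/entriesP; rewrite /vmin.
  elim/big_ind : _ => //; first exact: head_entries.
  by move=> a b sa sb; rewrite /Num.min; case: ifP.
  by move=> i _; apply/entriesP; exists i.
exact: bigmin_le_cond.
Qed.

(* Note the transpose: agent [j] acts on agent [i] through [C j i]. *)
Definition vector_field (R : realType) (n : nat) (C : 'M[R]_n) (v : 'cV[R]_n)
    (i : 'I_n) : R :=
  - ((1 - v i 0) * v i 0) + \sum_j C j i * (1 - v j 0) * v j 0.

Definition has_right_derivative (R : realType) (f : R -> R) (s d : R) : Prop :=
  h^-1 * (f (s + h) - f s) @[h --> 0^'+] --> d.

(* Only the values of [x] on [[t 0, +oo[] matter: the derivative is two-sided
   inside each switching interval and one-sided at its left end point. *)
Definition is_solution (R : realType) (n : nat) (t : nat -> R)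
    (C : R -> 'M[R]_n) (x : R -> 'cV[R]_n) : Prop :=
  [/\ {within `[t 0%N, +oo[, continuous x},
      forall k i, has_right_derivative (fun s => x s i 0) (t k)
                    (vector_field (C (t k)) (x (t k)) i)
    & forall k s i, t k < s < t k.+1 ->
        is_derive s (1 : R) (fun u => x u i 0 : R)
                    (vector_field (C (t k)) (x s) i)].

(* Main.v *)
Require Import Defs.
From HB Require Import structures.
From mathcomp Require Import all_boot all_order all_algebra.
From mathcomp Require Import all_classical all_reals all_analysis.
From mathcomp Require Import ring lra.
Set Implicit Arguments.
Unset Strict Implicit.
Unset Printing Implicit Defensive.
Import Order.TTheory GRing.Theory Num.Theory.
Import numFieldNormedType.Exports.
Local Open Scope classical_set_scope.
Local Open Scope ring_scope.

(** Since [C] has unit column sums, the vector field is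
    [\sum_j C j i * (1 - x_i - x_j) * (x_j - x_i)], and on the simplex the
    weights [1 - x_i - x_j] with [i != j] are nonnegative: the system is a
    consensus flow, so the maximum decreases and the minimum increases.
    An entry is multiplied by at least [expR (- tau)] over a time [tau], and an
    arc from a positive entry makes its head positive, so that all entries are
    positive after [n - m] blocks of [B] switching intervals.  From then on the
    weights lie between [l] and [1 - 2 * l].  Over [B * (n - 1)] intervals
    starting with maximum [h], a gap [h - x_i] shrinks at most by the factor
    [alpha], and an arc [j -> i] turns a gap [e] at [j] into a gap at least
    [gamma * e * (1 - expR (- (tauL * l)))] at [i].  Following the arcs from
    the minimal entry, after [n - 1] blocks all gaps exceed
    [alpha * mu ^+ (n - 1) * V], which contracts [V]. *)

(** * First-exit arguments *)

Lemma within_itv_near (R : realType) (a b : R) (f : R -> R) (s : R) :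
  {within `[a, b], continuous f} -> a <= s <= b ->
  forall e, 0 < e -> exists2 d, 0 < d &
    forall r, a <= r <= b -> `|r - s| < d -> `|f r - f s| < e.
Proof.
move=> /subspace_continuousP fc sab e e0.
have := fc s; rewrite /= in_itv /= sab => /(_ isT) /cvgrPdist_lt /(_ e e0).
rewrite /= near_withinE => -[d /= d0 fd]; exists d => // r rab rsd.
rewrite distrC; apply: fd; first by rewrite /= distrC.
by rewrite /= in_itv.
Qed.

Lemma derive_gt0_left (R : realType) (f : R -> R) (c d : R) :
  is_derive c (1 : R) f d -> 0 < d ->
  exists2 e, 0 < e & forall r, c - e < r < c -> f r < f c.
Proof.
move=> [fd <-] d0.
have /cvgrPdist_lt /(_ _ d0) [e /= e0 fe] := fd.
exists e => // r /andP[cer rc].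
have := fe (r - c); rewrite /= sub0r normrN ltr0_norm ?subr_lt0//.
rewrite subr_eq0 lt_eqF// => /(_ _ isT).
rewrite opprB ltrBlDr addrC -ltrBlDr cer => /(_ isT).
rewrite /GRing.scale /= mulr1 subrK => /ltr_distlBl; rewrite subrr.
by rewrite nmulr_rgt0 ?subr_lt0// invr_lt0 subr_lt0.
Qed.

(** Let [c] be the infimum of the times at which some component is nonpositive. By continuity all
    components are nonnegative at [c] and one of them vanishes; its positive derivative would make
    it negative just before [c], where all components are still positive. *)
Lemma inward_gt0 (R : realType) (I : finType) (a b : R) (u du : I -> R -> R) :
  (forall i, {within `[a, b], continuous (u i)}) ->
  (forall i s, a < s < b -> is_derive s (1 : R) (u i) (du i s)) ->
  (forall i, 0 < u i a) ->
  (forall i s, a < s < b -> u i s = 0 -> (forall j, 0 <= u j s) -> 0 < du i s) ->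
  forall i s, a <= s < b -> 0 < u i s.
Proof.
move=> uc ud ua inw i0 s0 /andP[as0 s0b]; rewrite ltNge; apply/negP => us0.
pose E : set R := [set s | a <= s <= s0 /\ exists i, u i s <= 0].
have E0 : E !=set0 by exists s0; split; [rewrite as0 lexx|exists i0].
have Elb : has_lbound E by exists a => s [/andP[]].
have Einf : has_inf E by split.
set c := inf E.
have ac : a <= c by apply: lb_le_inf => // s [/andP[]].
have cs0 : c <= s0 by apply: ge_inf => //; split; [rewrite as0 lexx|exists i0].
have cab : a <= c <= b by rewrite ac (le_trans cs0)// ltW.
have before i r : a <= r < c -> 0 < u i r.
  move=> /andP[ar rc]; rewrite ltNge; apply/negP => ur.
  have /(ge_inf Elb) : E r by split; [rewrite ar ltW// (lt_le_trans rc)|exists i].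
  by rewrite -/c leNgt rc.
have unneg j : 0 <= u j c.
  rewrite leNgt; apply/negP => ujc.
  have ac' : a < c.
    by rewrite lt_neqAle ac andbT; apply/eqP => aE; have := ua j; rewrite aE ltNge ltW.
  have nujc : 0 < - u j c by rewrite oppr_gt0.
  have [d d0 ujd] := within_itv_near (uc j) cab nujc.
  pose r := Num.max a (c - d / 2).
  have rc : r < c by rewrite gt_max ac' /= ltrBlDr ltrDl divr_gt0.
  have ar : a <= r by rewrite le_max lexx.
  have := before j r; rewrite ar rc => /(_ isT) ur.
  have := ujd r; rewrite ar (le_trans (ltW rc)) ?(andP cab).2// => /(_ isT).
  have : c - d / 2 <= r by rewrite le_max lexx orbT.
  rewrite ltr0_norm ?subr_lt0// => rd.
  have -> : - (r - c) < d by lra.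
  by move=> /(_ isT); rewrite ltr_norml => /andP[_]; lra.
have [i ui] : exists i, u i c <= 0.
  apply: contrapT => /forallNP ui.
  have ui' j : 0 < u j c by rewrite ltNge; apply/negP.
  have dP j : exists d, 0 < d /\ forall r, a <= r <= b -> `|r - c| < d -> 0 < u j r.
    have [d d0 ujd] := within_itv_near (uc j) cab (ui' j).
    exists d; split => // r rab /(ujd r rab); rewrite ltr_norml => /andP[+ _]; lra.
  have {}dP j : {d | 0 < d /\ forall r, a <= r <= b -> `|r - c| < d -> 0 < u j r}.
    exact/cid/dP.
  (* The least of finitely many radii of positivity would leave a stretch after [c] free of
     nonpositive values, against the infimum. *)
  pose d := \big[Num.min/1]_j sval (dP j).
  have d0 : 0 < d.
    rewrite /d; elim/big_ind : _ => // [x y x0 y0|j _]; first by rewrite lt_min x0.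
    by case: (svalP (dP j)).
  have [s [sab [k uks]] scd] := inf_adherent d0 Einf.
  have : 0 < u k s.
    have [_] := svalP (dP k); apply.
      by case/andP: sab => -> /= /le_trans; apply; exact: ltW.
    have cs : c <= s by apply: ge_inf => //; split => //; exists k.
    rewrite ger0_norm ?subr_ge0// ltrBlDl (lt_le_trans scd)// lerD2l.
    exact: bigmin_le_cond.
  by rewrite ltNge uks.
have uic : u i c = 0 by apply/eqP; rewrite eq_le ui unneg.
have ac' : a < c.
  by rewrite lt_neqAle ac andbT; apply/eqP => aE; have := ua i; rewrite aE uic ltxx.
have cab' : a < c < b by rewrite ac' (le_lt_trans cs0).
have [e e0 ue] := derive_gt0_left (ud i c cab') (inw i c cab' uic unneg).
pose r := Num.max a (c - e / 2).
have rc : r < c by rewrite gt_max ac' /= ltrBlDr ltrDl divr_gt0.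
have ar : a <= r by rewrite le_max lexx.
have : c - e / 2 <= r by rewrite le_max lexx orbT.
move=> rd.
have := ue r; rewrite rc andbT uic.
have -> : c - e < r by lra.
by move=> /(_ isT); rewrite ltNge ltW// before// ar.
Qed.

Lemma is_derive_expR_affine (R : realType) (K a s : R) :
  is_derive s (1 : R) (fun r : R => expR (K * (r - a))) (K * expR (K * (s - a))).
Proof.
have h1 : is_derive s (1 : R) (K \*: (@idfun R - cst a)) K.
  by apply: is_derive_eq; rewrite /GRing.scale /= subr0 mulr1.
by rewrite mulrC; exact: (is_derive1_comp (is_derive_expR _) h1).
Qed.

Lemma continuous_expR_affine (R : realType) (K a : R) :
  continuous (fun r : R => expR (K * (r - a))).
Proof.
move=> s; apply: continuous_comp; last exact: continuous_expR.
apply: cvgM; first exact: cvg_cst.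
by apply: cvgB; [exact: cvg_id|exact: cvg_cst].
Qed.

(* Compare with [- eps * expR ((K + 1) * (s - a))] for small [eps]: at a first
   contact the derivative condition becomes strict, as [inward_gt0] requires. *)
Lemma barrier (R : realType) (I : finType) (a b K eta0 : R) (u du : I -> R -> R) :
  a <= b -> 0 <= K -> 0 < eta0 ->
  (forall i, {within `[a, b], continuous (u i)}) ->
  (forall i s, a < s < b -> is_derive s (1 : R) (u i) (du i s)) ->
  (forall i, 0 <= u i a) ->
  (forall i s eta, a < s < b -> 0 < eta <= eta0 -> u i s = - eta ->
     (forall j, - eta <= u j s) -> - (K * eta) <= du i s) ->
  forall i, 0 <= u i b.
Proof.
move=> ab K0 eta00 uc ud ua inw i0.
rewrite leNgt; apply/negP => ub.
have {}ab : a < b.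
  by rewrite lt_neqAle ab andbT; apply: contraTneq ub => <-; rewrite -leNgt.
pose L := K + 1; have L0 : 0 < L by rewrite /L; lra.
pose M := expR (L * (b - a)); have M0 : 0 < M by exact: expR_gt0.
(* The first bound keeps [eta] inside the range where the contact hypothesis is available; the
   second keeps it below half of [- u i0 b]. *)
pose eps := Num.min (eta0 / M) (- u i0 b / 2 / M).
have eps0 : 0 < eps by rewrite lt_min !divr_gt0// oppr_gt0.
pose eta s := eps * expR (L * (s - a)).
have eta_gt0 s : 0 < eta s by rewrite mulr_gt0// expR_gt0.
have etaM s : s <= b -> eta s <= eps * M.
  by move=> sb; rewrite ler_pM2l// ler_expR ler_pM2l// lerD2r.
have eta_le s : s <= b -> eta s <= eta0.
  by move=> /etaM /le_trans; apply; rewrite -ler_pdivlMr// ge_min lexx.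
have eta_le2 s : s <= b -> eta s <= - u i0 b / 2.
  by move=> /etaM /le_trans; apply; rewrite -ler_pdivlMr// ge_min lexx orbT.
have deta s : is_derive s (1 : R) eta (L * eta s).
  rewrite /eta mulrCA; exact: (is_deriveZ _ (is_derive_expR_affine _ _ _)).
have ceta : continuous eta.
  by move=> s; apply: cvgM; [exact: cvg_cst|exact: continuous_expR_affine].
have pos : forall i s, a <= s < b -> 0 < u i s + eta s.
  apply: (@inward_gt0 _ _ _ _ (fun i => u i + eta) (fun i s => du i s + L * eta s)).
  - move=> i; apply: within_continuousD => //; exact: continuous_subspaceT.
  - by move=> i s sab; apply: is_deriveD; exact: ud.
  - by move=> i; rewrite ltr_wpDl.
  - move=> i s sab ui uj.
    have sb : s <= b by case/andP: sab => _ /ltW.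
    have := inw i s (eta s) sab; rewrite eta_gt0 eta_le// => /(_ isT) => h.
    have -> // : - (K * eta s) <= du i s -> 0 < du i s + L * eta s.
      by have := eta_gt0 s; rewrite /L; move=> *; lra.
    apply: h; first by move/eqP: ui; rewrite addr_eq0 => /eqP.
    by move=> j; rewrite -sub0r lerBlDr; exact: uj.
(* [pos] stops short of [b]. Close to [b], continuity puts [u i0] below [u i0 b / 2], while [pos]
   and [eta_le2] put it above. *)
have bab : a <= b <= b by rewrite (ltW ab) lexx.
have nub : 0 < - u i0 b / 2 by rewrite divr_gt0// oppr_gt0.
have [d d0 ud'] := within_itv_near (uc i0) bab nub.
pose r := Num.max a (b - d / 2).
have rb : r < b by rewrite gt_max ab /= ltrBlDr ltrDl divr_gt0.
have ar : a <= r by rewrite le_max lexx.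
have rd : b - d / 2 <= r by rewrite le_max lexx orbT.
have := ud' r; rewrite ar (ltW rb) => /(_ isT).
rewrite ltr0_norm ?subr_lt0// ltr_norml.
have -> : - (r - b) < d by lra.
move=> /(_ isT) /andP[_].
have := pos i0 r; rewrite ar rb => /(_ isT).
have := eta_le2 r (ltW rb); lra.
Qed.

(** * The flow of a single interaction matrix *)

Definition flow_on (R : realType) (n : nat) (C : 'M[R]_n) (x : R -> 'cV[R]_n)
    (a b : R) : Prop :=
  (forall i, {within `[a, b], continuous (fun s => x s i 0)}) /\
  (forall s i, a < s < b ->
     is_derive s (1 : R) (fun r => x r i 0 : R) (vector_field C (x s) i)).

Definition simplex_within (R : realType) (n : nat) (l h : R) (v : 'cV[R]_n) : Prop :=
  simplex v /\ forall i, l <= v i 0 <= h.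

Lemma flow_onW (R : realType) (n : nat) (C : 'M[R]_n) x a b a' b' :
  flow_on C x a b -> a <= a' -> b' <= b -> flow_on C x a' b'.
Proof.
move=> [xc xd] aa' b'b; split=> [i|s i /andP[as_ sb]].
  apply: continuous_subspaceW (xc i) => s /=; rewrite !in_itv /= => /andP[a's sb'].
  by rewrite (le_trans aa') ?(le_trans sb').
by apply: xd; rewrite (le_lt_trans aa' as_) (lt_le_trans sb).
Qed.

(** Unit column sums spread the loss term over the incoming arcs; then [(1 - y) * y - (1 - x) * x =
    (1 - x - y) * (y - x)]. *)
Lemma vector_field_diff (R : realType) (n : nat) (C : 'M[R]_n) v i :
  doubly_stochastic C ->
  vector_field C v i =
    \sum_j C j i * ((1 - v i 0 - v j 0) * (v j 0 - v i 0)).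
Proof.
move=> [_ _ Ccol]; rewrite /vector_field -[X in - X]mul1r -(Ccol i).
rewrite mulr_suml -sumrN -big_split /=; apply: eq_bigr => j _; ring.
Qed.

Lemma simplex_addr_le1 (R : realType) (n : nat) (v : 'cV[R]_n) i j :
  simplex v -> i != j -> v i 0 + v j 0 <= 1.
Proof.
move=> [v0 <-] ij; rewrite (bigD1 i)//= (bigD1 j) 1?eq_sym//= addrA lerDl.
by apply: sumr_ge0.
Qed.

Lemma simplex_le1 (R : realType) (n : nat) (v : 'cV[R]_n) i :
  simplex v -> v i 0 <= 1.
Proof.
by move=> [v0 <-]; rewrite (bigD1 i)//= lerDl sumr_ge0.
Qed.

(** With [n >= 3] there is a third index, whose entry is at least [l] and belongs to the remaining
    mass. This bounds the weight of an arc from below. *)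
Lemma simplex_within_sum3 (R : realType) (n : nat) (l h : R) (v : 'cV[R]_n) i j :
  (3 <= n)%N -> simplex_within l h v -> i != j -> l <= 1 - v i 0 - v j 0.
Proof.
move=> n3 [[v0 v1] vl] ij.
have /set0Pn[k] : ~: [set i; j]%SET != finset.set0.
  by rewrite -card_gt0 -(ltn_add2l #|[set i; j]%SET|) cardsC card_ord cards2 ij.
rewrite !inE negb_or => /andP[ki kj].
rewrite -v1 (bigD1 i)//= (bigD1 j) 1?eq_sym//= (bigD1 k) /=; last by rewrite ki kj.
have := vl k => /andP[vk _].
have : 0 <= \sum_(i0 < n | (i0 != i) && (i0 != j) && (i0 != k)) v i0 0 by exact: sumr_ge0.
set S := \sum_(_ | _) _ => S0; lra.
Qed.

(** Unit row sums mean that what [j] loses is exactly what it sends out, so the total has zero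
    derivative. *)
Lemma flow_sum (R : realType) (n : nat) (C : 'M[R]_n) x a b :
  doubly_stochastic C -> a <= b -> flow_on C x a b ->
  \sum_i x b i 0 = \sum_i x a i 0.
Proof.
move=> Cds ab [xc xd]; apply/eqP; rewrite -subr_eq0.
pose f := \sum_(i < n) (fun s : R => x s i 0 : R).
have fE s : f s = \sum_i x s i 0 by rewrite /f fct_sumE.
have fc : {within `[a, b], continuous f}.
  rewrite /f; elim/big_ind : _ => //; last exact: within_continuousD.
  by move=> s; exact: cvg_cst.
have fd s : s \in `]a, b[ -> is_derive s (1 : R) f 0.
  rewrite in_itv /= => sab.
  have df : is_derive s (1 : R) f (\sum_i vector_field C (x s) i).
    by apply: is_derive_sum => i; exact: xd.
  apply: (is_derive_eq df).
  rewrite /vector_field big_split /= exchange_big /= -big_split /= big1// => j _.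
  case: Cds => _ Crow _.
  by under eq_bigr do rewrite -mulrA; rewrite -mulr_suml Crow mul1r addNr.
have [c _] := MVT_segment ab fd fc.
by rewrite mul0r !fE => ->.
Qed.

Lemma flow_simplex (R : realType) (n : nat) (C : 'M[R]_n) x a b :
  doubly_stochastic C -> a <= b -> flow_on C x a b ->
  simplex (x a) -> simplex (x b).
Proof.
move=> Cds ab xf [xa0 xa1]; split; last by rewrite (flow_sum Cds ab xf).
case: n => [|n] in C x Cds xf xa0 xa1 *; first by case.
(* The dimension is now [n.+1]. Entries at least [- eta] with unit sum are at most [1 + n * eta], so
   a weight may be slightly negative; [n.+1 * eta <= 1] bounds [x_j + eta] by 2, and each term is at
   least [- (2 * n.+1 * eta)]. *)
apply: (@barrier _ _ a b (2 * n.+1%:R) n.+1%:R^-1 (fun i s => x s i 0)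
          (fun i s => vector_field C (x s) i)) => //.
- by case: xf.
- by move=> i s sab; case: xf => _; apply.
move=> i s eta /andP[as_ sb] /andP[eta0 etan] xi xj.
have sum1 : \sum_i x s i 0 = 1.
  by rewrite (flow_sum Cds (ltW as_) (flow_onW xf (lexx a) (ltW sb))).
have xj_le j : x s j 0 <= 1 + n%:R * eta.
  have := sum1; rewrite (bigD1 j)//= => S1.
  have : \sum_(k | k != j) (- eta) <= \sum_(k | k != j) x s k 0 by apply: ler_sum.
  rewrite sumr_const cardC1 card_ord -mulr_natl; lra.
have neta : n.+1%:R * eta <= 1 by rewrite -ler_pdivlMl// mulr1.
rewrite vector_field_diff//; case: (Cds) => C0 _ Ccol.
have -> : - (2 * n.+1%:R * eta) = \sum_j C j i * - (2 * n.+1%:R * eta).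
  by rewrite -mulr_suml Ccol mul1r.
apply: ler_sum => j _; apply: ler_wpM2l => //; rewrite xi.
have := xj_le j; have := xj j; move: neta; rewrite -natr1.
have : 0 <= n%:R * eta by rewrite mulr_ge0// ltW.
have -> : 2 * (n%:R + 1) * eta = 2 * (n%:R * eta) + 2 * eta by ring.
rewrite mulrDl mul1r; move: (x s j 0) (n%:R * eta) => y Z Z0 Z1 y0 y1.
have -> : (1 - - eta - y) * (y - - eta) = (1 + eta - y) * (y + eta) by ring.
have : 0 <= (1 + Z - y) * (y + eta) by rewrite mulr_ge0//; lra.
have : (Z - eta) * (y + eta) <= 2 * Z + 2 * eta by nra.
nra.
Qed.

(** At a contact, [x_i = h + eta] dominates every entry, so on the simplex all terms of the
    consensus form are nonpositive and [barrier] applies with [K = 0]. *)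
Lemma flow_upper (R : realType) (n : nat) (C : 'M[R]_n) x a b h :
  doubly_stochastic C -> a <= b -> flow_on C x a b -> simplex (x a) ->
  (forall i, x a i 0 <= h) -> forall i, x b i 0 <= h.
Proof.
move=> Cds ab xf xa xah i; rewrite -subr_ge0; move: i.
apply: (@barrier _ _ a b 0 1 (fun i => cst h - (fun s => x s i 0))
          (fun i s => 0 - vector_field C (x s) i)) => //.
- move=> i; apply: within_continuousB; last by case: xf.
  by move=> s; exact: cvg_cst.
- by move=> i s sab; case: xf => _ /(_ s i sab) ?; apply: is_deriveB.
- by move=> i; rewrite subr_ge0.
move=> i s eta /andP[as_ sb] /andP[eta0 _] xi xj.
have xs := flow_simplex Cds (ltW as_) (flow_onW xf (lexx a) (ltW sb)) xa.
rewrite mul0r sub0r lerN2 vector_field_diff// sumr_le0// => j _.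
case: (Cds) => C0 _ _; rewrite mulr_ge0_le0//.
have [<-|ij] := eqVneq i j; first by rewrite subrr mulr0.
rewrite mulr_ge0_le0//.
  by have := simplex_addr_le1 xs ij; lra.
have := xj j : - eta <= h - x s j 0; have := xi : h - x s i 0 = - eta; lra.
Qed.

Lemma flow_lower (R : realType) (n : nat) (C : 'M[R]_n) x a b l :
  doubly_stochastic C -> a <= b -> flow_on C x a b -> simplex (x a) ->
  (forall i, l <= x a i 0) -> forall i, l <= x b i 0.
Proof.
move=> Cds ab xf xa xal i; rewrite -subr_ge0; move: i.
apply: (@barrier _ _ a b 0 1 (fun i => (fun s => x s i 0) - cst l)
          (fun i s => vector_field C (x s) i - 0)) => //.
- move=> i; apply: within_continuousB; first by case: xf.
  by move=> s; exact: cvg_cst.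
- by move=> i s sab; case: xf => _ /(_ s i sab) ?; apply: is_deriveB.
- by move=> i; rewrite subr_ge0.
move=> i s eta /andP[as_ sb] /andP[eta0 _] xi xj.
have xs := flow_simplex Cds (ltW as_) (flow_onW xf (lexx a) (ltW sb)) xa.
rewrite mul0r oppr0 addr0 vector_field_diff// sumr_ge0// => j _.
case: (Cds) => C0 _ _; rewrite mulr_ge0//.
have [<-|ij] := eqVneq i j; first by rewrite subrr mulr0.
rewrite mulr_ge0//.
  by have := simplex_addr_le1 xs ij; lra.
have := xj j : - eta <= x s j 0 - l; have := xi : x s i 0 - l = - eta; lra.
Qed.

Lemma flow_simplex_within (R : realType) (n : nat) (C : 'M[R]_n) x a b l h :
  doubly_stochastic C -> a <= b -> flow_on C x a b ->
  simplex_within l h (x a) -> simplex_within l h (x b).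
Proof.
move=> Cds ab xf [xa xalh]; split; first exact: (flow_simplex Cds ab xf xa).
have xal j : l <= x a j 0 by have /andP[] := xalh j.
have xah j : x a j 0 <= h by have /andP[] := xalh j.
by move=> i; rewrite (flow_lower Cds ab xf xa xal) (flow_upper Cds ab xf xa xah).
Qed.

(** * Comparison estimates for one interaction matrix *)

(** The comparison curve solves [g' = k * (c - g)] with [g a = f0]. The differential inequality is
    demanded only on or below that curve, which is all a contact argument sees; [flow_gap_gain]
    relies on this weak form. *)
Lemma relaxation_ge (R : realType) (a b k c f0 : R) (f df : R -> R) :
  a <= b -> {within `[a, b], continuous f} ->
  (forall s, a < s < b -> is_derive s (1 : R) f (df s)) ->
  f0 <= f a ->
  (forall s, a < s < b -> f s <= c + (f0 - c) * expR (- k * (s - a)) ->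
     k * (c - f s) <= df s) ->
  c + (f0 - c) * expR (- k * (b - a)) <= f b.
Proof.
move=> ab fc fd fa fk.
pose g s := c + (f0 - c) * expR (- k * (s - a)).
rewrite -[leLHS]/(g b) -subr_ge0.
have gd s : is_derive s (1 : R) g ((f0 - c) * (- k * expR (- k * (s - a)))).
  rewrite -[X in is_derive _ _ _ X]add0r.
  apply: is_deriveD.
  exact: (is_deriveZ _ (is_derive_expR_affine _ _ _)).
have gc : continuous g.
  move=> s; apply: cvgD; first exact: cvg_cst.
  by apply: cvgM; [exact: cvg_cst|exact: continuous_expR_affine].
(* At [f = g - eta] the derivative of [f - g] is at least [k * eta]; the sign of [k] is free, hence
   the absolute value. *)
apply: (@barrier _ unit a b `|k| 1 (fun=> f - g)
  (fun=> fun s => df s - (f0 - c) * (- k * expR (- k * (s - a))))) => //.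
- by move=> _; apply: within_continuousB => //; exact: continuous_subspaceT.
- by move=> _ s sab; apply: is_deriveB; exact: fd.
- by move=> _; rewrite subr_ge0 /g subrr mulr0 expR0 mulr1 addrC subrK.
- move=> _ s eta sab /andP[eta0 _] fg _.
  have {}fg : f s - g s = - eta := fg.
  have fsg : f s <= g s by lra.
  have := fk s sab fsg.
  have -> : f s = g s - eta by lra.
  rewrite /g; move: (expR _) => e h.
  have : - `|k| * eta <= k * eta by rewrite ler_pM2r// lerNl -normrN ler_norm.
  nra.
Qed.

(** For distinct agents the weight lies between 0 and [1 - 2 * l], and [x_j - x_i <= h - x_i];
    averaging over a column of unit sum keeps the bound. *)
Lemma vector_field_le (R : realType) (n : nat) (C : 'M[R]_n) l h v i :
  doubly_stochastic C -> zero_diagonal C -> simplex_within l h v ->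
  vector_field C v i <= (1 - 2 * l) * (h - v i 0).
Proof.
move=> Cds Cz [vs vlh]; rewrite vector_field_diff//; case: (Cds) => C0 _ Ccol.
rewrite -[leRHS]mul1r -[X in _ <= X * _](Ccol i) mulr_suml; apply: ler_sum => j _.
have [<-|ij] := eqVneq i j; first by rewrite Cz !mul0r.
apply: ler_wpM2l => //.
have /andP[li hi] := vlh i; have /andP[lj hj] := vlh j.
have w0 := simplex_addr_le1 vs ij.
have : 0 <= (1 - v i 0 - v j 0) * (h - v j 0) by rewrite mulr_ge0//; lra.
have : 0 <= (v i 0 - l + (v j 0 - l)) * (h - v i 0) by rewrite mulr_ge0//; lra.
nra.
Qed.

Lemma vector_field_ge (R : realType) (n : nat) (C : 'M[R]_n) v i j :
  doubly_stochastic C -> simplex v ->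
  C j i * ((1 - v j 0) * v j 0) - v i 0 <= vector_field C v i.
Proof.
move=> [C0 _ _] vs; case: (vs) => v0 _.
rewrite /vector_field addrC; apply: lerD.
  by rewrite lerN2; have := v0 i; nra.
rewrite (bigD1 j)//= mulrA lerDl sumr_ge0// => k _.
by rewrite !mulr_ge0// subr_ge0 simplex_le1.
Qed.

Lemma flow_gap_ge (R : realType) (n : nat) (C : 'M[R]_n) x a b l h i :
  doubly_stochastic C -> zero_diagonal C -> a <= b -> flow_on C x a b ->
  simplex_within l h (x a) ->
  expR (- (1 - 2 * l) * (b - a)) * (h - x a i 0) <= h - x b i 0.
Proof.
move=> Cds Cz ab xf xa.
rewrite mulrC -[X in X * _]subr0 -[leLHS]add0r.
apply: (@relaxation_ge _ a b (1 - 2 * l) 0 (h - x a i 0)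
  (cst h - (fun s => x s i 0)) (fun s => 0 - vector_field C (x s) i)) => //.
- apply: within_continuousB; last by case: xf.
  by move=> s; exact: cvg_cst.
- by move=> s sab; case: xf => _ /(_ s i sab) ?; apply: is_deriveB.
- move=> s /andP[as_ sb] _.
  have xs := flow_simplex_within Cds (ltW as_) (flow_onW xf (lexx a) (ltW sb)) xa.
  have := vector_field_le i Cds Cz xs.
  rewrite -[(_ - _) s]/(h - x s i 0); lra.
Qed.

Lemma flow_entry_ge (R : realType) (n : nat) (C : 'M[R]_n) x a b i :
  doubly_stochastic C -> a <= b -> flow_on C x a b -> simplex (x a) ->
  expR (- (b - a)) * x a i 0 <= x b i 0.
Proof.
move=> Cds ab xf xa.
have -> : expR (- (b - a)) * x a i 0 =
  0 + (x a i 0 - 0) * expR (- 1 * (b - a)) by rewrite mulN1r; ring.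
apply: (@relaxation_ge _ a b 1 0 (x a i 0)
  (fun s => x s i 0) (fun s => vector_field C (x s) i)) => //.
- by case: xf.
- by move=> s sab; case: xf => _; apply.
- move=> s /andP[as_ sb] _.
  have xs := flow_simplex Cds (ltW as_) (flow_onW xf (lexx a) (ltW sb)) xa.
  have := vector_field_ge i i Cds xs.
  have : 0 <= C i i * ((1 - x s i 0) * x s i 0).
    case: Cds => C0 _ _; case: (xs) => xs0 _.
    by rewrite !mulr_ge0// subr_ge0 simplex_le1.
  lra.
Qed.

(** [x_j] stays above its exponential decay and [1 - x_j] above [1 - h], so [i] receives at least
    [p] and loses at most [x_i]: it relaxes toward [p] from a nonnegative start. *)
Lemma flow_entry_gt0 (R : realType) (n : nat) (C : 'M[R]_n) x a b i j h :
  doubly_stochastic C -> a < b -> flow_on C x a b -> simplex (x a) ->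
  (forall k, x a k 0 <= h) -> h < 1 -> 0 < C j i -> 0 < x a j 0 ->
  0 < x b i 0.
Proof.
move=> Cds ab xf xa xh h1 Cji xj.
pose p := C j i * ((1 - h) * (expR (- (b - a)) * x a j 0)).
have p0 : 0 < p by rewrite !mulr_gt0 ?expR_gt0 ?subr_gt0.
have := @relaxation_ge _ a b 1 p 0
  (fun s => x s i 0) (fun s => vector_field C (x s) i) (ltW ab).
rewrite sub0r mulN1r => rel.
apply: lt_le_trans (rel _ _ _ _).
- have : expR (- (b - a)) < 1 by rewrite -expR0 ltr_expR oppr_lt0 subr_gt0.
  nra.
- by case: xf.
- by move=> s sab; case: xf => _; apply.
- by case: xa.
- move=> s /andP[as_ sb] _.
  have xs := flow_simplex Cds (ltW as_) (flow_onW xf (lexx a) (ltW sb)) xa.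
  have xsh := flow_upper Cds (ltW as_) (flow_onW xf (lexx a) (ltW sb)) xa xh j.
  have xsj := flow_entry_ge j Cds (ltW as_) (flow_onW xf (lexx a) (ltW sb)) xa.
  have := vector_field_ge i j Cds xs.
  suff : p <= C j i * ((1 - x s j 0) * x s j 0) by lra.
  rewrite /p; apply: ler_wpM2l; first exact: ltW.
  apply: ler_pM.
  + by rewrite subr_ge0 ltW.
  + by rewrite mulr_ge0 ?expR_ge0// ltW.
  + by rewrite lerD2l lerN2.
  apply: le_trans xsj; apply: ler_wpM2r; first exact: ltW.
  by rewrite ler_expR lerN2 lerD2r ltW.
Qed.

(* Terms with [x_k > x_i] carry weights [1 - x_i - x_k] smaller than the weight
   [1 - x_i - x_j] of the low neighbour [j], and the other terms only help, so
   this single weight can be used for all of them. *)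
Lemma vector_field_pull (R : realType) (n : nat) (C : 'M[R]_n) h v i j :
  doubly_stochastic C -> simplex v -> i != j ->
  (forall k, v k 0 <= h) -> v j 0 <= v i 0 ->
  vector_field C v i <=
    (1 - v i 0 - v j 0) * ((h - v i 0) - C j i * (h - v j 0)).
Proof.
move=> Cds vs ij vh vji; rewrite vector_field_diff//; case: (Cds) => C0 _ Ccol.
have w0 : 0 <= 1 - v i 0 - v j 0 by have := simplex_addr_le1 vs ij; lra.
have -> : (1 - v i 0 - v j 0) * ((h - v i 0) - C j i * (h - v j 0)) =
  (1 - v i 0 - v j 0) * (h - v i 0) - C j i * ((1 - v i 0 - v j 0) * (h - v j 0)) by ring.
rewrite -[X in _ <= X - _]mul1r -[X in _ <= X * _ - _](Ccol i) mulr_suml.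
rewrite (bigD1 j)//= [X in _ <= X - _](bigD1 j)//=.
set S := \sum_(_ | _) _; set T := \sum_(_ | _) _.
suff : S <= T by move=> ST; lra.
apply: ler_sum => k kj; apply: ler_wpM2l => //.
have [<-|ik] := eqVneq i k.
  by rewrite subrr mulr0 mulr_ge0// subr_ge0.
have := simplex_addr_le1 vs ik; have := vh k; have := vh i.
have [vki|vik] := lerP (v k 0) (v i 0); nra.
Qed.

(** The gap at [i] is compared with a relaxation toward [g * e] at rate [l], the least possible
    weight. While the gap is at most [g * e <= e], agent [j] is the lower one and
    [vector_field_pull] applies; [relaxation_ge] asks for no more. *)
Lemma flow_gap_gain (R : realType) (n : nat) (C : 'M[R]_n) x a b l h g e i j :
  (3 <= n)%N -> doubly_stochastic C -> i != j ->
  a <= b -> flow_on C x a b -> simplex_within l h (x a) ->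
  0 <= l -> 0 <= g -> 0 <= e -> g <= C j i -> g <= 1 ->
  (forall s, a <= s <= b -> e <= h - x s j 0) ->
  g * e * (1 - expR (- (l * (b - a)))) <= h - x b i 0.
Proof.
move=> n3 Cds ij ab xf xa l0 g0 e0 gC g1 xe.
have -> : g * e * (1 - expR (- (l * (b - a)))) =
  g * e + (0 - g * e) * expR (- l * (b - a)) by rewrite mulNr; ring.
apply: (@relaxation_ge _ a b l (g * e) 0
  (cst h - (fun s => x s i 0)) (fun s => 0 - vector_field C (x s) i)) => //.
- apply: within_continuousB; last by case: xf.
  by move=> s; exact: cvg_cst.
- by move=> s sab; case: xf => _ /(_ s i sab) ?; apply: is_deriveB.
- by rewrite subr_ge0; case: xa => _ /(_ i) /andP[].
- move=> s /andP[as_ sb]; rewrite -[(_ - _) s]/(h - x s i 0) => xi.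
  have xs := flow_simplex_within Cds (ltW as_) (flow_onW xf (lexx a) (ltW sb)) xa.
  have es : e <= h - x s j 0 by apply: xe; rewrite !ltW.
  have ge0 : 0 <= g * e by rewrite mulr_ge0.
  have {}xi : h - x s i 0 <= g * e.
    apply: (le_trans xi); rewrite sub0r mulNr gerBl mulr_ge0 ?expR_ge0//.
  have gee : g * e <= e by rewrite ler_piMl.
  have vh k : x s k 0 <= h by case: xs => _ /(_ k) /andP[].
  have ji : x s j 0 <= x s i 0 by lra.
  have := vector_field_pull Cds xs.1 ij vh ji.
  have := simplex_within_sum3 n3 xs ij.
  have : g * e <= C j i * (h - x s j 0) by apply: ler_pM.
  nra.
Qed.

(** * Growth along strongly connected unions *)

Lemma strongly_connected_exit (T : finType) (e : rel T) (S : {set T}) :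
  strongly_connected e -> S != finset.set0 -> S != [set: T]%SET ->
  exists j i, [/\ j \in S, i \notin S & e j i].
Proof.
move=> econ /set0Pn[j jS] ST.
have /fintype.subsetPn[i _ iS] : ~~ ([set: T]%SET \subset S).
  by rewrite finset.subTset.
have /connectP[p] := econ j i.
elim: p j jS => [j jS _ ij|k p IHp j jS /= /andP[jk kp] il].
  by move: iS; rewrite ij jS.
have [kS|kS] := boolP (k \in S); first exact: IHp kS kp il.
by exists j, k.
Qed.

(** As long as [S r] is not everything, its block contains an arc leaving it, whose head joins
    [S r.+1]: one new element per block. This serves both for the positive entries and for the
    agents with a guaranteed gap. *)
Lemma strongly_connected_growth (T : finType) (G : nat -> rel T) (B M : nat)
    (S : nat -> {set T}) :
  (forall r, (r < M)%N -> strongly_connected (union_graph G (r * B) B)) ->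
  S 0%N != finset.set0 ->
  (forall r, (r < M)%N -> S r \subset S r.+1) ->
  (forall r k j i, (r < M)%N -> (r * B <= k < r.+1 * B)%N -> G k j i ->
     j \in S r -> i \in S r.+1) ->
  forall r, (r <= M)%N -> (minn #|T| (#|S 0%N| + r) <= #|S r|)%N.
Proof.
move=> Gcon S0 Smono Sstep; elim=> [_|r IHr rM]; first by rewrite addn0 geq_minr.
have {}IHr := IHr (ltnW rM).
have [ST|ST] := eqVneq (S r) [set: T]%SET.
  apply: (leq_trans (geq_minl _ _)).
  by rewrite -cardsT -ST subset_leq_card// Smono.
have Sr0 : S r != finset.set0.
  have : (0 < #|S r|)%N.
    apply: leq_trans IHr; rewrite leq_min addn_gt0 card_gt0 S0 andbT.
    by case/set0Pn: S0 => z _; apply/card_gt0P; exists z.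
  by rewrite card_gt0.
have [j [i [jS iS /hasP[k]]]] := strongly_connected_exit (Gcon r rM) Sr0 ST.
rewrite mem_iota addnC -mulSn => rk Gji.
have : i |: S r \subset S r.+1.
  by rewrite finset.subUset finset.sub1set (Sstep r k j i)//= Smono.
move=> /subset_leq_card; rewrite cardsU1 iS add1n.
rewrite !geq_min addnS; move: IHr; rewrite geq_min => /orP[] h1 h2.
  by rewrite (leq_trans h1 (ltnW h2)).
by rewrite (leq_ltn_trans h1 h2) orbT.
Qed.

(** Two distinct entries are each at least [l] and add up to at most 1. This makes the decay rate
    [1 - 2 * l] nonnegative. *)
Lemma simplex_within_le_half (R : realType) (n : nat) (l h : R) (v : 'cV[R]_n) :
  (2 <= n)%N -> simplex_within l h v -> 2 * l <= 1.
Proof.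
case: n v => [|[|n]]// v _ [vs vlh].
have := @simplex_addr_le1 _ _ v ord0 (lift ord0 ord0) vs isT.
have := vlh ord0; have := vlh (lift ord0 ord0); lra.
Qed.

(** * Switched solutions *)

Section SwitchingTimes.
Variables (R : realType) (t : nat -> R) (tauU tauL : R).
Hypothesis (tauL_gt0 : 0 < tauL).
Hypothesis (dwell : forall k, tauL <= t k.+1 - t k <= tauU).

Lemma dwell_lt k : t k < t k.+1.
Proof. by have := dwell k; move: tauL_gt0; lra. Qed.

Lemma switch_le k p : (k <= p)%N -> t k <= t p.
Proof.
move=> /subnK <-; elim: (p - k)%N => // q IHq.
by rewrite addSn (le_trans IHq)// ltW// dwell_lt.
Qed.

Lemma switch_sub_le k p : t (k + p)%N - t k <= p%:R * tauU.
Proof.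
elim: p => [|p IHp]; first by rewrite addn0 subrr mul0r.
by rewrite addnS -natr1; have := dwell (k + p); lra.
Qed.

Lemma switch_sub_ge k : k%:R * tauL <= t k - t 0%N.
Proof.
elim: k => [|k IHk]; first by rewrite subrr mul0r.
by rewrite -natr1; have := dwell k; lra.
Qed.

(** The lower dwell bound makes the switching times unbounded; the first one beyond [s] closes the
    wanted interval. *)
Lemma switch_locate s : t 0%N <= s -> exists k, t k <= s < t k.+1.
Proof.
move=> s0.
have ex : exists k, s < t k.
  exists (Num.truncn ((s - t 0%N) / tauL)).+1.
  have := switch_sub_ge (Num.truncn ((s - t 0%N) / tauL)).+1.
  have : (s - t 0%N) / tauL < (Num.truncn ((s - t 0%N) / tauL)).+1%:R.
    exact: truncnS_gt.
  by rewrite ltr_pdivrMr//; lra.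
case: (ex_minnP ex) => -[|k] sk kmin; first by move: sk; rewrite ltNge s0.
exists k; rewrite sk andbT leNgt; apply/negP => /kmin.
by rewrite ltnn.
Qed.

(** This carries facts about a single flow over to the switched solution: cut at the switching times
    and compose. *)
Lemma switch_ind (Q : R -> R -> Prop) :
  (forall s1 s2 s3, Q s1 s2 -> Q s2 s3 -> Q s1 s3) ->
  (forall k s1 s2, t k <= s1 -> s1 <= s2 -> s2 <= t k.+1 -> Q s1 s2) ->
  forall s1 s2, t 0%N <= s1 -> s1 <= s2 -> Q s1 s2.
Proof.
move=> Qtr Qloc s1 s2 s10 s12.
have [k /andP[ks1 s1k]] := switch_locate s10.
have [p /andP[ps2 s2p]] := switch_locate (le_trans s10 s12).
have [pk|kp] := leqP p k.
  apply: (Qloc k) => //; apply: (le_trans (ltW s2p)); exact: switch_le.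
apply: (Qtr _ (t k.+1)); first exact: (Qloc k) ks1 (ltW s1k) (lexx _).
apply: (Qtr _ (t p)); last exact: (Qloc p) (lexx _) ps2 (ltW s2p).
rewrite -(subnK kp); elim: (p - k.+1)%N => [|q IHq].
  exact: (Qloc k) (ltW (dwell_lt k)) (lexx _) (lexx _).
apply: Qtr IHq _; rewrite addSn.
exact: (Qloc _) (lexx _) (ltW (dwell_lt _)) (lexx _).
Qed.

End SwitchingTimes.

Section SwitchedSystem.
Variables (R : realType) (n : nat) (t : nat -> R) (C : R -> 'M[R]_n).
Variables (gamma : R) (B : nat) (tauU tauL : R) (x : R -> 'cV[R]_n).
Hypothesis (n_ge3 : (3 <= n)%N).
Hypothesis (C_ds : forall k, doubly_stochastic (C (t k)) /\ zero_diagonal (C (t k))).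
Hypothesis (tauL_gt0 : 0 < tauL).
Hypothesis (dwell : forall k, tauL <= t k.+1 - t k <= tauU).
Hypothesis (sol : is_solution t C x).

Let n_gt0 : (0 < n)%N. Proof. exact: ltn_trans n_ge3. Qed.

Lemma solution_flow k a b :
  t k <= a -> b <= t k.+1 -> flow_on (C (t k)) x a b.
Proof.
move=> ka bk; case: sol => xc _ xd.
apply: (@flow_onW _ _ _ _ (t k) (t k.+1)) => //; split=> [i|s i]; last exact: xd.
have sub : `[t k, t k.+1]%classic `<=` `[t 0%N, +oo[%classic.
  move=> s /=; rewrite !in_itv /= andbT => /andP[ks _].
  by apply: le_trans ks; exact: (switch_le tauL_gt0 dwell (leq0n k)).
have xc' := continuous_subspaceW sub xc.
move=> s; apply: (@continuous_comp _ _ _ (x : subspace `[t k, t k.+1]%classic -> _)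
  (fun M : 'cV[R]_n => M i 0)); [exact: xc'|exact: coord_continuous].
Qed.

Lemma solution_simplex a b :
  t 0%N <= a -> a <= b -> simplex (x a) -> simplex (x b).
Proof.
move: a b; apply: (switch_ind tauL_gt0 dwell) => [s1 s2 s3 h12 h23 /h12/h23//|].
move=> k a b ka ab bk; exact: (flow_simplex (C_ds k).1 ab (solution_flow ka bk)).
Qed.

(** Invariance and decay are proved jointly, because the decay on a second piece needs the bounds at
    the intermediate time; the exponents then add up. *)
Lemma solution_gap l h a b :
  t 0%N <= a -> a <= b -> simplex_within l h (x a) ->
  simplex_within l h (x b) /\
  forall i, expR (- (1 - 2 * l) * (b - a)) * (h - x a i 0) <= h - x b i 0.
Proof.
move: a b; apply: (switch_ind tauL_gt0 dwell) => [s1 s2 s3 h12 h23 /h12[/h23[x3 g23] g12]|].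
  split=> // i; apply: le_trans (g23 i).
  have -> : - (1 - 2 * l) * (s3 - s1) =
     - (1 - 2 * l) * (s3 - s2) + - (1 - 2 * l) * (s2 - s1) by ring.
  by rewrite expRD -mulrA ler_wpM2l ?expR_ge0.
move=> k a b ka ab bk xa; have xf := solution_flow ka bk.
have [Cds Cz] := C_ds k; split; first exact: (flow_simplex_within Cds ab xf xa).
by move=> i; exact: (flow_gap_ge i Cds Cz ab xf xa).
Qed.

Lemma solution_entry_gt0 i a b :
  t 0%N <= a -> a <= b -> simplex (x a) -> 0 < x a i 0 -> 0 < x b i 0.
Proof.
move=> a0 ab xa xi.
(* Membership in the simplex is carried along so that the claim composes across switching times. *)
suff [//] : simplex (x b) /\ 0 < x b i 0.
move: a b a0 ab xa xi; apply: (switch_ind tauL_gt0 dwell).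
  by move=> s1 s2 s3 h12 h23 xa xi; have [] := h12 xa xi; exact: h23.
move=> k a b ka ab bk xa xi; have xf := solution_flow ka bk.
have [Cds _] := C_ds k; split; first exact: (flow_simplex Cds ab xf xa).
apply: lt_le_trans (flow_entry_ge i Cds ab xf xa).
by rewrite mulr_gt0// expR_gt0.
Qed.

(** * Positivity of all entries after [n - m] blocks *)

Hypothesis (C_conn : forall l : nat,
  strongly_connected (union_graph (fun k => digraph_of (C (t k))) l B)).

Lemma union_graph_shift (T : Type) (G : nat -> rel T) k l i j :
  union_graph (fun p => G (k + p)%N) l B i j = union_graph G (k + l) B i j.
Proof.
by rewrite /union_graph /= iotaDl has_map.
Qed.

(** Positive entries stay positive, and an active arc passes positivity to its head by the end of
    its interval. Starting from [m] positive entries, one more per block exhausts the [n] agents. *)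
Lemma solution_vmin_gt0 h m :
  simplex (x (t 0%N)) -> (forall i, x (t 0%N) i 0 <= h) -> h < 1 ->
  #|[set i : 'I_n | x (t 0%N) i 0 != 0]%SET| = m ->
  0 < vmin (x (t ((n - m) * B)%N)).
Proof.
move=> x0 xh h1 xm.
pose S r := [set i : 'I_n | 0 < x (t (r * B)%N) i 0]%SET.
have t0k k : t 0%N <= t k by exact: (switch_le tauL_gt0 dwell).
have xs k : simplex (x (t k)) by exact: (solution_simplex (lexx _) (t0k k)).
have xsh k i : x (t k) i 0 <= h.
  have x0h : simplex_within 0 h (x (t 0%N)).
    by split=> // j; rewrite xh andbT; case: x0.
  by have [[_ /(_ i) /andP[]]] := solution_gap (lexx _) (t0k k) x0h.
have S0 : S 0%N = [set i : 'I_n | x (t 0%N) i 0 != 0]%SET.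
  by apply/setP => i; rewrite !inE mul0n lt0r; case: x0 => -> _; rewrite andbT.
have S0n : S 0%N != finset.set0.
  apply/eqP => S0e; have [x00 x01] := x0.
  have : \sum_i x (t 0%N) i 0 = 0.
    rewrite big1// => i _; apply/eqP; rewrite eq_le x00 andbT leNgt.
    by have := finset.in_set0 i; rewrite -S0e inE mul0n => ->.
  by rewrite x01; apply/eqP; rewrite oner_eq0.
have mle : (m <= n)%N by rewrite -xm (leq_trans (max_card _))// card_ord.
have := @strongly_connected_growth _ (fun k => digraph_of (C (t k))) B (n - m) S
  _ S0n _ _ (n - m)%N (leqnn _).
rewrite card_ord S0 xm subnKC// minnn => /(_ _ _ _) Sn.
have [i ->] := (vminP (x (t ((n - m) * B)%N)) n_gt0).1.
suff : i \in S (n - m)%N by rewrite inE.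
suff -> : S (n - m)%N = [set: 'I_n]%SET by rewrite inE.
apply/eqP; rewrite eqEcard finset.subsetT cardsT card_ord; apply: Sn => //.
- move=> r _; apply/fintype.subsetP => j; rewrite !inE.
  apply: solution_entry_gt0 => //; apply: (switch_le tauL_gt0 dwell).
  by rewrite leq_mul2r leqnSn orbT.
- move=> r k j i' _ /andP[rk kr] Cji; rewrite !inE => xj.
  have xjk : 0 < x (t k) j 0.
    by apply: solution_entry_gt0 xj => //; exact: (switch_le tauL_gt0 dwell).
  have xik : 0 < x (t k.+1) i' 0.
    exact: (flow_entry_gt0 (C_ds k).1 (dwell_lt tauL_gt0 dwell k)
             (solution_flow (lexx _) (lexx _)) (xs k) (xsh k) h1 Cji xjk).
  by apply: solution_entry_gt0 xik => //; exact: (switch_le tauL_gt0 dwell).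
Qed.

(** * Contraction of the spread over windows of [B * (n - 1)] intervals *)

Hypothesis (gamma_gt0 : 0 < gamma).
Hypothesis (C_gamma : forall k i j, C (t k) i j != 0 -> gamma <= C (t k) i j).

(** A row of unit sum has a nonzero entry, which lies between [gamma] and 1. *)
Lemma gamma_le1 : gamma <= 1.
Proof.
have [[C0 Crow _] _] := C_ds 0.
have [j Cj] : exists j, C (t 0%N) (Ordinal n_gt0) j != 0.
  apply: contrapT => /forallNP C00; have := Crow (Ordinal n_gt0).
  rewrite big1 => [/esym/eqP|j _]; first by rewrite oner_eq0.
  by have /negP := C00 j; rewrite negbK => /eqP.
apply: le_trans (C_gamma Cj) _.
by rewrite -(Crow (Ordinal n_gt0)) (bigD1 j)//= lerDl sumr_ge0.
Qed.

Section Contraction.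
Variable l : R.
Hypothesis l_gt0 : 0 < l.
Let N := (B * (n - 1))%N.
Let alpha := expR (- (tauU * N%:R * (1 - 2 * l))).
Let mu := alpha * gamma * (1 - expR (- (tauL * l))).
Let delta := alpha * mu ^+ (n - 1).
Hypothesis l_half : 2 * l <= 1.

Let gain_itv : 0 < 1 - expR (- (tauL * l)) < 1.
Proof.
by rewrite subr_gt0 gtrBl expR_gt0 andbT -[ltRHS]expR0 ltr_expR oppr_lt0 mulr_gt0.
Qed.

Let tauU_gt0 : 0 < tauU.
Proof. by have := dwell 0; move: tauL_gt0; lra. Qed.

Lemma alpha_itv : 0 < alpha <= 1.
Proof.
rewrite expR_gt0 /= -[leRHS]expR0 ler_expR oppr_le0 mulr_ge0// ?subr_ge0//.
by rewrite mulr_ge0// ltW.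
Qed.

Lemma mu_itv : 0 < mu < 1.
Proof.
have /andP[a0 a1] := alpha_itv; have /andP[e0 e1] := gain_itv.
rewrite !mulr_gt0//=.
apply: le_lt_trans e1; rewrite ler_piMl ?(ltW e0)//.
by rewrite mulr_ile1 ?(ltW a0) ?(ltW gamma_gt0) ?gamma_le1.
Qed.

Lemma delta_itv : 0 < delta < 1.
Proof.
have /andP[a0 a1] := alpha_itv; have /andP[m0 m1] := mu_itv.
rewrite mulr_gt0 ?exprn_gt0//=.
apply: le_lt_trans (_ : mu ^+ (n - 1) < 1).
  by rewrite ler_piMl// exprn_ge0// ltW.
by rewrite exprn_ilt1 ?(ltW m0)// -lt0n subn_gt0 (ltn_trans _ n_ge3).
Qed.

Lemma solution_contraction k :
  simplex (x (t k)) -> l <= vmin (x (t k)) ->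
  vmax (x (t (k + N)%N)) - vmin (x (t (k + N)%N)) <=
    (1 - delta) * (vmax (x (t k)) - vmin (x (t k))).
Proof.
move=> xk lk; set h := vmax (x (t k)); set V := h - _.
have [[imin iminE] minP] := vminP (x (t k)) n_gt0.
have [_ maxP] := vmaxP (x (t k)) n_gt0.
have V0 : 0 <= V by rewrite subr_ge0 iminE; exact: maxP.
have /andP[a0 a1] := alpha_itv; have /andP[m0 m1] := mu_itv.
have /andP[e0 e1] := gain_itv.
have t0k p : t 0%N <= t p by exact: (switch_le tauL_gt0 dwell).
have tle p q : (p <= q)%N -> t p <= t q by exact: (switch_le tauL_gt0 dwell).
have xin : simplex_within l h (x (t k)).
  by split=> // i; rewrite (le_trans lk)//=; exact: maxP.
have xs s : t k <= s -> simplex_within l h (x s).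
  by move=> ks; have [] := solution_gap (t0k k) ks xin.
have decay i a b : t k <= a -> a <= b -> b <= t (k + N)%N ->
    alpha * (h - x a i 0) <= h - x b i 0.
  move=> ka ab bN.
  have [_ /(_ i)] := solution_gap (le_trans (t0k k) ka) ab (xs a ka).
  apply: le_trans; apply: ler_wpM2r.
    by rewrite subr_ge0; case: (xs a ka) => _ /(_ i) /andP[].
  rewrite ler_expR mulNr lerN2 [leRHS]mulrC ler_wpM2l ?subr_ge0//.
  rewrite mulrC; have := switch_sub_le dwell k N; lra.
(* The gap is required up to the end of the window, so that it is still there whenever a later arc
   out of [i] becomes active. *)
pose P r i := forall s, t (k + r * B)%N <= s -> s <= t (k + N)%N ->
  alpha * mu ^+ r * V <= h - x s i 0.
pose S r := [set i : 'I_n | `[< P r i >]]%SET.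
have imin0 : imin \in S 0%N.
  rewrite inE; apply/asboolP => s; rewrite mul0n addn0 expr0 mulr1 => ks sN.
  by rewrite /V iminE; exact: decay.
have S0 : S 0%N != finset.set0 by apply/set0Pn; exists imin.
have := @strongly_connected_growth _ (fun p => digraph_of (C (t (k + p)%N)))
  B (n - 1) S _ S0 _ _ (n - 1)%N (leqnn _).
rewrite card_ord => /(_ _ _ _) Sn.
have {}Sn : (minn n (#|S 0%N| + (n - 1)) <= #|S (n - 1)%N|)%N.
  apply: Sn => [r _ i j|r rn|r p j i rn /andP[rp pr] Cji].
  - rewrite (eq_connect (union_graph_shift (fun p => digraph_of (C (t p))) k (r * B))).
    exact: C_conn.
  - apply/fintype.subsetP => i; rewrite !inE => Pi s ks sN.
    apply: le_trans (Pi s _ sN).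
      rewrite ler_wpM2r// ler_wpM2l ?(ltW a0)// exprS ler_piMl ?ltW//.
      by rewrite exprn_gt0.
    by apply: le_trans ks; apply: tle; rewrite leq_add2l leq_mul2r leqnSn orbT.
  - rewrite !inE => Pj s ks sN.
    have pN : (k + p < k + N)%N.
      by rewrite ltn_add2l (leq_trans pr)// /N mulnC leq_mul2l rn orbT.
    have Cds := C_ds (k + p)%N.
    have {}Cji : 0 < C (t (k + p)%N) j i := Cji.
    have ij : i != j by apply: contraTneq Cji => ->; rewrite Cds.2 ltxx.
    have kp : t k <= t (k + p)%N by rewrite tle// leq_addr.
    have gC : gamma <= C (t (k + p)%N) j i by apply: C_gamma; rewrite gt_eqF.
    have e_ge0 : 0 <= alpha * mu ^+ r * V.
      by rewrite !mulr_ge0 ?exprn_ge0 ?(ltW a0) ?(ltW m0).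
    have Pj' s' : t (k + p)%N <= s' <= t (k + p).+1 ->
        alpha * mu ^+ r * V <= h - x s' j 0.
      move=> /andP[ps' s'p]; apply: Pj.
        by apply: le_trans ps'; rewrite tle// leq_add2l.
      by apply: (le_trans s'p); exact: tle.
    have := flow_gap_gain n_ge3 Cds.1 ij (ltW (dwell_lt tauL_gt0 dwell (k + p)))
      (solution_flow (lexx _) (lexx _)) (xs _ kp) (ltW l_gt0) (ltW gamma_gt0)
      e_ge0 gC gamma_le1 Pj'.
    (* The gain is secured at [t (k + p).+1]; keeping it until the end of the window costs one more
       factor [alpha], the one contained in [mu]. *)
    move=> gain; apply: le_trans (decay i (t (k + p).+1) s _ _ sN).
    + rewrite (_ : alpha * mu ^+ r.+1 * V = alpha *
        (gamma * (alpha * mu ^+ r * V) * (1 - expR (- (tauL * l)))));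
        last by rewrite exprS /mu; ring.
      apply: ler_wpM2l; first exact: ltW.
      apply: le_trans gain; apply: ler_wpM2l; first by rewrite mulr_ge0 ?(ltW gamma_gt0).
      rewrite lerD2l lerN2 ler_expR lerN2 [leLHS]mulrC ler_wpM2l ?(ltW l_gt0)//.
      by have /andP[] := dwell (k + p).
    + by rewrite tle// -addnS leq_addr.
    + by apply: le_trans ks; rewrite tle// -addnS leq_add2l.
have {}Sn : S (n - 1)%N = [set: 'I_n]%SET.
  apply/eqP; rewrite eqEcard finset.subsetT cardsT card_ord.
  apply: leq_trans Sn; rewrite leq_min leqnn /= -[X in (X <= _)%N](subnKC n_gt0).
  by rewrite leq_add2r card_gt0.
have kN : t k <= t (k + N)%N by rewrite tle// leq_addr.
have [[i1 ->] _] := vmaxP (x (t (k + N)%N)) n_gt0.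
have [[i2 ->] _] := vminP (x (t (k + N)%N)) n_gt0.
have : i1 \in S (n - 1)%N by rewrite Sn finset.in_setT.
rewrite !inE => /(_ (t (k + N)%N)).
rewrite [((n - 1) * B)%N]mulnC lexx -/delta => /(_ isT isT) h1.
(* The uniform floor [l] served for the constants; here the floor is the actual minimum, which does
   not decrease, so only the maximum side has to contract. *)
have xmin : simplex_within (vmin (x (t k))) h (x (t k)).
  by split=> // i; rewrite minP; exact: maxP.
have [[_ /(_ i2) /andP[h2 _]] _] := solution_gap (t0k k) kN xmin.
by rewrite mulrBl mul1r; move: h1 h2; rewrite /V; lra.
Qed.

Lemma solution_diameter_le a b :
  t 0%N <= a -> a <= b -> simplex (x a) ->
  vmax (x b) - vmin (x b) <= vmax (x a) - vmin (x a).
Proof.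
move=> a0 ab xa.
have xin : simplex_within (vmin (x a)) (vmax (x a)) (x a).
  by split=> // i; rewrite (vminP _ n_gt0).2 (vmaxP _ n_gt0).2.
have [[_ xb] _] := solution_gap a0 ab xin.
have [[i ->] _] := vmaxP (x b) n_gt0; have [[j ->] _] := vminP (x b) n_gt0.
have /andP[_ bi] := xb i; have /andP[bj _] := xb j; lra.
Qed.

(** Here [p] counts the complete windows between [t K] and the interval [k] containing [s]. At most
    [N] intervals precede [t K] and fewer than [N] follow the last complete window, whence [2 * N];
    [k.+1] includes the interval of [s] itself. *)
Lemma solution_decay K s :
  (0 < B)%N -> (K <= N)%N -> simplex (x (t 0%N)) -> l <= vmin (x (t K)) ->
  t 0%N <= s -> exists k p,
    [/\ s - t 0%N <= k.+1%:R * tauU, (k <= 2 * N + p * N)%N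
      & vmax (x s) - vmin (x s) <=
          (1 - delta) ^+ p * (vmax (x (t 0%N)) - vmin (x (t 0%N)))].
Proof.
move=> B0 KN x0 lK s0; have [k /andP[ks sk]] := switch_locate tauL_gt0 dwell s0.
have N_gt0 : (0 < N)%N by rewrite muln_gt0 B0 subn_gt0 (ltn_trans _ n_ge3).
have tle p q : (p <= q)%N -> t p <= t q by exact: (switch_le tauL_gt0 dwell).
have sk' : s - t 0%N <= k.+1%:R * tauU.
  by have := switch_sub_le dwell 0 k.+1; rewrite add0n; lra.
have q0 : 0 <= 1 - delta by have /andP[_] := delta_itv; lra.
have [kK|Kk] := ltnP k K.
  (* Before [t K] no contraction is claimed, only monotonicity of the spread. *)
  exists k, 0%N; split=> //.
    by rewrite addn0 (leq_trans (ltnW kK))// (leq_trans KN)// leq_pmull.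
  by rewrite expr0 mul1r; exact: solution_diameter_le.
exists k, ((k - K) %/ N)%N; set p := ((k - K) %/ N)%N; split=> //.
  rewrite -(subnKC Kk) mul2n -addnn -addnA leq_add// {1}(divn_eq (k - K) N) addnC.
  by rewrite leq_add2r ltnW// ltn_mod.
have tKp r : simplex (x (t (K + r * N)%N)).
  by apply: (solution_simplex (lexx _)) x0; exact: tle.
have lKp r : l <= vmin (x (t (K + r * N)%N)).
  have [[i ->] _] := vminP (x (t (K + r * N)%N)) n_gt0.
  have xK : simplex_within l (vmax (x (t K))) (x (t K)).
    split=> [|j]; first by have := tKp 0%N; rewrite addn0.
    by rewrite (le_trans lK ((vminP _ n_gt0).2 j)) (vmaxP _ n_gt0).2.
  by have [[_ /(_ i) /andP[]]] := solution_gap (tle _ _ (leq0n K))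
    (tle _ _ (leq_addr (r * N) K)) xK.
have iter r : vmax (x (t (K + r * N)%N)) - vmin (x (t (K + r * N)%N)) <=
    (1 - delta) ^+ r * (vmax (x (t 0%N)) - vmin (x (t 0%N))).
  elim: r => [|r IHr].
    by rewrite mul0n addn0 expr0 mul1r; apply: solution_diameter_le => //; exact: tle.
  rewrite mulSn addnCA addnC exprS -mulrA.
  apply: le_trans (ler_wpM2l q0 IHr).
  exact: solution_contraction.
apply: le_trans (iter p).
apply: solution_diameter_le => //; first exact: tle.
apply: le_trans ks; apply: tle; rewrite -[leqRHS](subnKC Kk) leq_add2l.
exact: leq_divM.
Qed.

End Contraction.
End SwitchedSystem.

(** * From the contraction to the limit and the rate *)

Lemma simplex_lt1 (R : realType) (n : nat) (v : 'cV[R]_n) i :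
  simplex v -> ~ @simplex_vertices R n v -> v i 0 < 1.
Proof.
move=> vs nv; rewrite lt_neqAle simplex_le1// andbT; apply/eqP => vi; apply: nv.
exists i => //; apply/matrixP => j k; rewrite mxE ord1 eqxx andbT.
have [->|ji] := eqVneq j i; first by rewrite vi.
apply/esym/eqP; rewrite mulr0n eq_le vs.1 andbT.
by have := simplex_addr_le1 vs ji; rewrite vi; lra.
Qed.

(** The mean of the entries is [1 / n], so it lies between the minimum and the maximum, as does
    every entry. *)
Lemma simplex_mean_dist (R : realType) (n : nat) (v : 'cV[R]_n) i :
  simplex v -> `|n%:R^-1 - v i 0| <= vmax v - vmin v.
Proof.
move=> [v0 v1].
have n0 : (0 < n)%N by case: n i {v0 v1} v => // -[].
have [_ vx] := vmaxP v n0; have [_ vn] := vminP v n0.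
have nR : 0 < n%:R :> R by rewrite ltr0n.
have lo : vmin v <= n%:R^-1.
  rewrite -[leRHS]mul1r ler_pdivlMr// mulr_natr -[leRHS]v1.
  rewrite -[X in _ *+ X]card_ord -sumr_const.
  exact: ler_sum.
have up : n%:R^-1 <= vmax v.
  rewrite -[leLHS]mul1r ler_pdivrMr// mulr_natr -[leLHS]v1.
  rewrite -[X in _ *+ X]card_ord -sumr_const.
  exact: ler_sum.
have := vx i; have := vn i; rewrite ler_norml => *; apply/andP; split; lra.
Qed.

Lemma exp_bound_cvg (R : realType) (f : R -> R) (c A lambda : R) :
  0 <= A -> 0 < lambda ->
  (forall s, 0 <= s -> `|c - f s| <= A * expR (- (lambda * s))) ->
  f s @[s --> +oo] --> c.
Proof.
move=> A0 l0 fc; apply/cvgrPdist_le => e e0; near=> s.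
have s0 : 0 < s by near: s; exact: nbhs_pinfty_gt.
apply: le_trans (fc s (ltW s0)) _.
rewrite expRN ler_pdivrMr ?expR_gt0//.
(* This threshold suffices by [1 + y <= expR y] at [y = lambda * s]. *)
have se : A / e / lambda <= s by near: s; apply: nbhs_pinfty_ge; rewrite num_real.
have : A / e <= lambda * s by rewrite [leRHS]mulrC -ler_pdivrMr.
have := expR_ge1Dx (lambda * s); rewrite ler_pdivrMr// => h1 h2.
apply: (le_trans h2); rewrite [leLHS]mulrC; apply: ler_wpM2l; [exact: ltW|lra].
Unshelve. all: by end_near. Qed.

Theorem theorem1 (R : realType) (n : nat) (t : nat -> R) (C : R -> 'M[R]_n)
  (gamma : R) (B : nat) (tauU tauL : R)
  (n_ge3 : (3 <= n)%N)
  (t0 : t 0%N = 0)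
  (t_incr : forall k, t k < t k.+1)
  (C_stoch : forall s : R, 0 <= s -> row_stochastic (C s) /\ zero_diagonal (C s))
  (C_pconst : forall k (s : R), t k <= s < t k.+1 -> C s = C (t k))
  (A1_stoch : forall k,
     doubly_stochastic (C (t k)) /\ zero_diagonal (C (t k)))
  (A1_gamma0 : 0 < gamma)
  (A1_gamma : forall k i j, C (t k) i j != 0 -> gamma <= C (t k) i j)
  (A2_B : (1 <= B)%N)
  (A2_conn : forall l : nat,
     strongly_connected (union_graph (fun k => digraph_of (C (t k))) l B))
  (A3_tauU : 0 < tauU) (A3_tauL : 0 < tauL)
  (A3_dwell : forall k, tauL <= t k.+1 - t k <= tauU) :
  (forall x : R -> 'cV[R]_n, is_solution t C x ->
     simplex (x (t 0%N)) -> forall s : R, t 0%N <= s -> simplex (x s))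
  /\
  (forall (x : R -> 'cV[R]_n) (m : nat), is_solution t C x ->
     (@simplex R n `\` @simplex_vertices R n) (x (t 0%N)) ->
     #|[set i : 'I_n | x (t 0%N) i 0 != 0]%SET| = m ->
     (2 <= m)%N ->
     let V := fun s : R => vmax (x s) - vmin (x s) in
     let l := vmin (x (t ((n - m) * B)%N)) in
     let alpha := expR (- (tauU * (B * (n - 1))%:R * (1 - 2 * l))) in
     let mu := alpha * gamma * (1 - expR (- (tauL * l))) in
     let delta := alpha * mu ^+ (n - 1) in
     let lambda := ln ((1 - delta)^-1) / (B%:R * tauU * (n - 1)%:R) in
     [/\ forall i, x s i 0 @[s --> +oo] --> (n%:R^-1 : R),
         0 < l,
         0 < lambda
       & forall s : R, t 0%N <= s ->
           V s <= (1 - delta)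
                    `^ (- ((1 + 2 * B * (n - 1))%:R / (B * (n - 1))%:R))
                  * expR (- (lambda * s)) * V (t 0%N)]).
Proof.
have n0 : (0 < n)%N by exact: ltn_trans n_ge3.
split=> [x sol x0 s s0|x m sol [x0 nvert] xm m2 V l alpha mu delta lambda].
  exact: (solution_simplex A1_stoch A3_tauL A3_dwell sol (lexx _) s0 x0).
have h1 : vmax (x (t 0%N)) < 1.
  by have [[i ->] _] := vmaxP (x (t 0%N)) n0; exact: simplex_lt1.
have l0 : 0 < l.
  exact: (solution_vmin_gt0 n_ge3 A1_stoch A3_tauL A3_dwell sol A2_conn x0
    (vmaxP _ n0).2 h1 xm).
have tK : t 0%N <= t ((n - m) * B)%N by exact: (switch_le A3_tauL A3_dwell).
have xK := solution_simplex A1_stoch A3_tauL A3_dwell sol (lexx _) tK x0.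
have l_half : 2 * l <= 1.
  apply: (@simplex_within_le_half _ _ _ (vmax (x (t ((n - m) * B)%N))) _ (ltnW n_ge3)).
  by split; [exact: xK|move=> i; rewrite (vminP _ n0).2 (vmaxP _ n0).2].
have /andP[d0 d1] : 0 < delta < 1.
  exact: (delta_itv B n_ge3 A1_stoch A3_tauL A3_dwell A1_gamma0 A1_gamma l0 l_half).
set N := (B * (n - 1))%N in alpha mu delta lambda d0 d1 *.
have N_gt0 : (0 < N)%N by rewrite muln_gt0 A2_B subn_gt0 (ltn_trans _ n_ge3).
have NR : 0 < N%:R :> R by rewrite ltr0n.
pose L := - ln (1 - delta).
have qpos : 0 < 1 - delta by rewrite subr_gt0.
have L0 : 0 < L.
  rewrite /L -lnV ?posrE// ln_gt0// invf_gt1// gtrBl//.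
have lambdaE : lambda = L / (N%:R * tauU).
  by rewrite /lambda lnV ?posrE// natrM /L; congr (_ / _); ring.
have lambda0 : 0 < lambda by rewrite lambdaE divr_gt0// mulr_gt0.
have V0 s : 0 <= V s.
  by rewrite subr_ge0; have [[i ->] _] := vmaxP (x s) n0; exact: (vminP _ n0).2.
have Vle s : t 0%N <= s ->
    V s <= (1 - delta) `^ (- ((1 + 2 * B * (n - 1))%:R / N%:R))
           * expR (- (lambda * s)) * V (t 0%N).
  move=> s0.
  have KN : ((n - m) * B <= N)%N.
    by rewrite mulnC leq_mul2l leq_sub2l ?orbT// ltnW.
  have [k [p [sk kp Vp]]] := solution_decay n_ge3 A1_stoch A3_tauL A3_dwell sol
    A2_conn A1_gamma0 A1_gamma l0 l_half A2_B KN x0 (lexx _) s0.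
  apply: le_trans Vp _; apply: ler_wpM2r; first exact: V0.
  (* Everything becomes an exponential, and after division by [L] the claim is
     [- p <= (1 + 2 * N - s / tauU) / N]. It follows from
     [s / tauU <= k.+1 <= 1 + 2 * N + p * N]. *)
  rewrite /powR gt_eqF// -expRD -[X in X ^+ p]lnK ?posrE// -expRM_natl ler_expR.
  have -> : ln (1 - delta) = - L by rewrite /L opprK.
  rewrite lambdaE.
  have -> : - ((1 + 2 * B * (n - 1))%:R / N%:R) * - L - L / (N%:R * tauU) * s =
    L * (((1 + 2 * B * (n - 1))%:R - s / tauU) / N%:R) by field; rewrite !gt_eqF.
  rewrite mulrN mulrC -mulrN ler_pM2l// ler_pdivlMr//.
  have : s / tauU <= k.+1%:R by rewrite ler_pdivrMr//; move: sk; rewrite t0 subr0.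
  have : k.+1%:R <= (1 + 2 * N + p * N)%:R :> R by rewrite ler_nat -addnA add1n ltnS.
  rewrite -mulnA -/N !natrD !natrM; lra.
split=> // i.
apply: (@exp_bound_cvg _ _ _
  ((1 - delta) `^ (- ((1 + 2 * B * (n - 1))%:R / N%:R)) * V (t 0%N)) lambda) => //.
  by rewrite mulr_ge0// powR_ge0.
move=> s s0.
have ts : t 0%N <= s by rewrite t0.
(* The spread dominates the distance of each entry to [1 / n], so the exponential bound yields the
   limit. *)
apply: le_trans (simplex_mean_dist i _) _.
  exact: (solution_simplex A1_stoch A3_tauL A3_dwell sol (lexx _) ts x0).
by rewrite mulrAC; exact: Vle.
Qed.
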